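(* Let $A\in\mathbb{R}^{m\times n}$, $m\ge n$, have the SVD $A=U\begin{pmatrix}\Sigma\\ \mathbf{0}\end{pmatrix}V^T$ with $U=(u_1,\dots,u_m)$ and $V=(v_1,\dots,v_n)$ orthogonal and $\Sigma=\mathrm{diag}(\sigma_1,\dots,\sigma_n)$, and let $b\in\mathbb{R}^m$ with $u_i^Tb\neq 0$ for $i=1,\dots,n$. Assume that $\min_x\|Ax-b\|$ is moderately or mildly ill-posed with singular values $\sigma_j=\zeta j^{-\alpha}$, $j=1,2,\ldots,n$, where $\alpha>\frac{1}{2}$ and $\zeta>0$ is some constant. Then $$\|\Delta_1\|\leq \frac{\max_{2\leq i\leq n}|u_i^Tb|}{|u_1^Tb|}\sqrt{\frac{1}{2\alpha-1}},$$ and, for $k=2,3,\ldots,n-1$, $$\|\Delta_k\|\leq \frac{\max_{k+1\leq i\leq n}|u_i^Tb|}{\min_{1\leq i\leq k}|u_i^Tb|}\sqrt{\frac{k^2}{4\alpha^2-1}+\frac{k}{2\alpha-1}}\;|L_{k_1}^{(k)}(0)|,$$ where $$|L_{k_1}^{(k)}(0)|=\max_{j=1,2,\ldots,k}|L_j^{(k)}(0)|,\qquad |L_j^{(k)}(0)|=\prod_{i=1,\,i\ne j}^k\frac{\sigma_i^2}{|\sigma_j^2-\sigma_i^2|},\quad j=1,2,\ldots,k.$$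
   Context: $\|\cdot\|$ is the 2-norm of a vector or the spectral norm of a matrix. Definition of $\Delta_k$ ($1\le k\le n-1$): let $D=\mathrm{diag}(\sigma_1u_1^Tb,\dots,\sigma_nu_n^Tb)\in\mathbb{R}^{n\times n}$ and let $T_k\in\mathbb{R}^{n\times k}$ be the matrix with $(i,l)$ entry $\sigma_i^{2(l-1)}$. Partition $D=\mathrm{diag}(D_1,D_2)$ and $T_k=\begin{pmatrix} T_{k1} \\ T_{k2} \end{pmatrix}$ with $D_1,T_{k1}\in\mathbb{R}^{k\times k}$; $T_{k1}$ is a nonsingular Vandermonde matrix. Then $\Delta_k=D_2T_{k2}T_{k1}^{-1}D_1^{-1}\in\mathbb{R}^{(n-k)\times k}$. (Then $\|\tan\Theta(\mathcal{V}_k,\mathcal{V}_k^R)\|=\|\Delta_k\|$, where $\mathcal{V}_k=\mathrm{span}\{v_1,\dots,v_k\}$, $\mathcal{V}_k^R=\mathrm{span}\{A^Tb,(A^TA)A^Tb,\dots,(A^TA)^{k-1}A^Tb\}$, and $\Theta$ denotes the canonical angles between the two subspaces.) The problem is called mildly ill-posed if $\frac12<\alpha\le1$ and moderately ill-posed if $\alpha>1$. *)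

(* Defs.v *)
From HB Require Import structures.
From mathcomp Require Import all_boot all_order all_algebra.
From mathcomp Require Import all_classical all_reals all_analysis.

Set Implicit Arguments.
Unset Strict Implicit.
Unset Printing Implicit Defensive.

Import Order.TTheory GRing.Theory Num.Theory.

Local Open Scope classical_set_scope.
Local Open Scope ring_scope.

(* Indices are 0-based throughout: i : 'I_n stands for the index i + 1. *)

Definition norm2 (R : realType) n (x : 'cV[R]_n) : R :=
  Num.sqrt (\sum_(i < n) x i 0 ^+ 2).

(* The canonical norm on matrices in the library is the entrywise max norm,
   hence this separate operator norm; the set is nonempty and bounded above
   (lemma spectral_norm_has_sup), so that sup is a genuine supremum. *)
Definition spectral_norm (R : realType) m n (M : 'M[R]_(m, n)) : R :=
  sup [set norm2 (M *m x) | x in [set x : 'cV[R]_n | norm2 x <= 1]].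

Lemma spectral_norm_has_sup (R : realType) m n (M : 'M[R]_(m, n)) :
  has_sup [set norm2 (M *m x) | x in [set x : 'cV[R]_n | norm2 x <= 1]].
Proof.
split.
  exists (norm2 (M *m 0)), 0 => //=.
  by rewrite /norm2 big1 ?sqrtr0 // => i _; rewrite mxE expr0n.
exists (Num.sqrt (\sum_(i < m) (\sum_(j < n) `|M i j|) ^+ 2)) => _ [x /= hx <-].
have x1 j : `|x j 0| <= 1.
  apply: le_trans hx; rewrite -sqrtr_sqr; apply: ler_wsqrtr.
  rewrite (bigD1 j) //= lerDl.
  by apply: sumr_ge0 => i _; apply: sqr_ge0.
apply: ler_wsqrtr; apply: ler_sum => i _.
rewrite -[leLHS]real_normK ?num_real// lerXn2r ?nnegrE ?sumr_ge0// mxE.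
apply: (le_trans (ler_norm_sum _ _ _)); apply: ler_sum => j _.
by rewrite normrM ler_piMr.
Qed.

(* Maximum and minimum of a nonempty list; both are 0 on the empty list. *)
Definition seq_max (R : realType) (s : seq R) : R :=
  \big[Num.max/head 0 s]_(x <- s) x.

Definition seq_min (R : realType) (s : seq R) : R :=
  \big[Num.min/head 0 s]_(x <- s) x.

(* For n <= m this is the block matrix diag(sigma) stacked on a zero block. *)
Definition rect_diag (R : realType) m n (sigma : 'I_n -> R) : 'M[R]_(m, n) :=
  \matrix_(i < m, j < n) (if i == j :> nat then sigma j else 0).

Definition is_svd (R : realType) m n (A : 'M[R]_(m, n)) (U : 'M[R]_m)
    (sigma : 'I_n -> R) (V : 'M[R]_n) : Prop :=
  [/\ U^T *m U = 1%:M,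
      V^T *m V = 1%:M,
      forall i, 0 <= sigma i,
      {homo sigma : i j / (i <= j)%N >-> j <= i}
    & A = U *m rect_diag m sigma *m V^T].

Definition fourier_coef (R : realType) m n (hnm : (n <= m)%N) (U : 'M[R]_m)
    (b : 'cV[R]_m) (i : 'I_n) : R :=
  ((col (widen_ord hnm i) U)^T *m b) 0 0.

Definition mildly_ill_posed (R : realType) (alpha : R) : Prop :=
  2^-1 < alpha <= 1.

Definition moderately_ill_posed (R : realType) (alpha : R) : Prop :=
  1 < alpha.

Definition power_decay (R : realType) n (sigma : 'I_n -> R) (zeta alpha : R) :
    Prop :=
  forall j : 'I_n, sigma j = zeta * (j.+1%:R `^ (- alpha)).

Section Delta.
Variables (R : realType) (n : nat) (sigma beta : 'I_n -> R).
Variables (k : nat) (hk : (k <= n)%N).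

Definition top_index (i : 'I_k) : 'I_n :=
  cast_ord (subnKC hk) (lshift (n - k) i).

Definition bot_index (i : 'I_(n - k)) : 'I_n :=
  cast_ord (subnKC hk) (rshift k i).

Definition Dmx : 'M[R]_n := diag_mx (\row_i (sigma i * beta i)).

Definition Tmx : 'M[R]_(n, k) :=
  \matrix_(i < n, l < k) sigma i ^+ (2 * l).

Definition Delta : 'M[R]_(n - k, k) :=
  mxsub bot_index bot_index Dmx *m rowsub bot_index Tmx
  *m invmx (rowsub top_index Tmx) *m invmx (mxsub top_index top_index Dmx).

End Delta.

(* |L_j^(k)(0)|, where L_j^(k) is the j-th Lagrange basis polynomial at the
   nodes sigma_1^2, ..., sigma_k^2. *)
Definition abs_lagrange0 (R : realType) n (sigma : 'I_n -> R) (k : nat)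
    (j : 'I_n) : R :=
  \prod_(i < n | (i < k)%N && (i != j))
    (sigma i ^+ 2 / `|sigma j ^+ 2 - sigma i ^+ 2|).

Definition max_abs_lagrange0 (R : realType) n (sigma : 'I_n -> R) (k : nat) :
    R :=
  seq_max [seq abs_lagrange0 sigma k j | j : 'I_n <- enum 'I_n & (j < k)%N].

(* Main.v *)
Require Import Defs.
From HB Require Import structures.
From mathcomp Require Import all_boot all_order all_algebra.
From mathcomp Require Import all_classical all_reals all_analysis.
From mathcomp Require Import ring lra.

Set Implicit Arguments.
Unset Strict Implicit.
Unset Printing Implicit Defensive.

Import Order.TTheory GRing.Theory Num.Theory.
Local Open Scope ring_scope.

(** Column [j] of the inverse Vandermonde matrix on the nodes
    [x_l = sigma_l ^ 2] lists the coefficients of the Lagrange polynomial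
    [L_j], so that the product of the lower Vandermonde block by this inverse
    consists of the values [L_j (sigma_i ^ 2)], and
    [Delta i j = sigma_i beta_i L_j (sigma_i ^ 2) / (sigma_j beta_j)]
    ([DeltaE]).  A node [sigma_i ^ 2] of the lower block lies between 0 and all
    the interpolation nodes, hence every factor [sigma_i ^ 2 - x_l] of the
    numerator is at most [x_l] in absolute value, and
    [|L_j (sigma_i ^ 2)| <= |L_j 0|] ([lagrange_le_at0]).

    Bounding the spectral norm by the Frobenius norm then separates the
    variables ([spectral_norm_Delta_le]): apart from the squared bounds on
    [|beta_i|], [1 / |beta_j|] and [|L_j 0|], the squared norm is at most
    [(sum_(i > k) sigma_i ^ 2) * (sum_(j <= k) sigma_j ^ -2)].

    For [sigma_j = zeta j ^ -alpha] the constant [zeta] cancels and, with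
    [p = 2 alpha > 1], integral comparison bounds the two sums by
    [k ^ (1 - p) / (p - 1)] and [k ^ p + k ^ (p + 1) / (p + 1)]
    ([sum_powRN_tail_le], [sum_powR_le]); their product is the quantity under
    the square root ([power_node_sums_le]).  For [k = 1] the second sum is
    exactly 1, and the only Lagrange polynomial is the constant 1, which gives
    the sharper first bound. *)

(** * Spectral and Frobenius norms *)

(** Expansion of [0 <= \sum_(i, j) (a_i x_j - a_j x_i) ^ 2]. *)
Lemma cauchy_schwarz_sum (R : realType) (I : finType) (a x : I -> R) :
  (\sum_i a i * x i) ^+ 2 <= (\sum_i a i ^+ 2) * (\sum_i x i ^+ 2).
Proof.
have : 0 <= \sum_i \sum_j (a i * x j - a j * x i) ^+ 2.
  by apply: sumr_ge0 => i _; apply: sumr_ge0 => j _; apply: sqr_ge0.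
have -> : \sum_i \sum_j (a i * x j - a j * x i) ^+ 2 =
    \sum_i \sum_j (a i ^+ 2 * x j ^+ 2) + \sum_i \sum_j (x i ^+ 2 * a j ^+ 2)
    - 2 * \sum_i \sum_j ((a i * x i) * (a j * x j)).
  rewrite mulr_sumr -!big_split -sumrB; apply: eq_bigr => i _ /=.
  rewrite mulr_sumr -!big_split -sumrB; apply: eq_bigr => j _ /=; ring.
rewrite -!big_distrlr/=; lra.
Qed.

Lemma spectral_norm_le_frobenius (R : realType) m n (M : 'M[R]_(m, n)) :
  spectral_norm M <= Num.sqrt (\sum_i \sum_j M i j ^+ 2).
Proof.
apply: ge_sup; first by have [] := spectral_norm_has_sup M.
move=> _ [x /= hx <-]; apply: ler_wsqrtr; apply: ler_sum => i _.
rewrite mxE; apply: le_trans (cauchy_schwarz_sum _ _) _.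
apply: ler_piMr; first by apply: sumr_ge0 => j _; apply: sqr_ge0.
move: hx; rewrite /norm2 -{1}sqrtr1 ler_psqrt ?nnegrE//.
by apply: sumr_ge0 => j _; apply: sqr_ge0.
Qed.

(** * Lagrange interpolation and the inverse Vandermonde matrix *)

Lemma vandermonde_unit (F : fieldType) (k : nat) (x : nat -> F) :
  injective x -> \matrix_(i < k, l < k) x i ^+ l \in unitmx.
Proof.
move=> x_inj; rewrite -unitmx_tr unitmxE.
have -> : (\matrix_(i < k, l < k) x i ^+ l)^T = Vandermonde k (\row_i x i).
  by apply/matrixP => i j; rewrite !mxE.
rewrite det_Vandermonde unitfE; apply/prodf_neq0 => i _; apply/prodf_neq0 => j ij.
by rewrite !mxE subr_eq0 (inj_eq x_inj) gtn_eqF.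
Qed.

(** The equality [(L_j (y_i)) *m vandermonde = (y_i ^ l)] is the exactness of
    interpolation on the monomials ['X^l] with [l < k]. *)
Lemma vandermonde_interpolation (F : fieldType) (m k : nat) (x : nat -> F)
    (y : 'I_m -> F) : injective x -> (0 < k)%N ->
  (\matrix_(i < m, l < k) y i ^+ l) *m invmx (\matrix_(i < k, l < k) x i ^+ l)
  = \matrix_(i < m, j < k) (tnth (lagrange k x) j : {poly F}).[y i].
Proof.
move=> x_inj k_gt0; apply: canLR (mulmxK (vandermonde_unit k x_inj)) _.
apply/matrixP => i l; rewrite !mxE -[LHS]hornerXn.
rewrite {1}(lagrange_gen k_gt0 x_inj (p := 'X^l)) ?size_polyXn// horner_sum.
by apply: eq_bigr => j _; rewrite !mxE hornerM hornerC hornerXn mulrC.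
Qed.

Lemma lagrange_eval (F : fieldType) k (x : nat -> F) (j : 'I_k) (y : F) :
   injective x -> (0 < k)%N ->
  (tnth (lagrange k x) j : {poly F}).[y]
  = \prod_(i < k | i != j) ((y - x i) / (x j - x i)).
Proof.
move=> x_inj k_gt0; rewrite lagrangeE// hornerM hornerC !horner_prod.
rewrite prodf_div mulrC.
by congr (_ / _); apply: eq_bigr => i _; rewrite hornerXsubC.
Qed.

(** * Integral comparison for sums of powers *)

(** For these exponents the power function is convex, hence above its tangents.
    Between consecutive integers it compares an increment of [x ^ r] with one
    term of a sum of powers, as integrating [r x ^ (r - 1)] would.  After
    scaling it reads [1 + r (t - 1) <= t ^ r], which follows from
    [1 + s ln t <= t ^ s], with [s = r] if [r <= 0] and [s = r - 1] if
    [1 <= r]. *)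
Lemma powR_tangent (R : realType) (x y r : R) : 0 < x -> 0 < y ->
  1 <= r \/ r <= 0 ->
  x `^ r + r * x `^ (r - 1) * (y - x) <= y `^ r.
Proof.
move=> x0 y0 hr.
have [t t0 ->] : exists2 t, 0 < t & y = t * x.
  by exists (y / x); rewrite ?divr_gt0// divfK ?gt_eqF.
have pow1B z : 0 < z -> z `^ (r - 1) = z `^ r / z.
  by move=> z0; rewrite powRB ?(gt_eqF z0) ?implybT// powRr1 ?ltW.
rewrite (pow1B _ x0).
rewrite powRM ?(ltW x0) ?(ltW t0)//.
have -> : x `^ r + r * (x `^ r / x) * (t * x - x) = (1 + r * (t - 1)) * x `^ r.
  by field; rewrite gt_eqF.
rewrite ler_wpM2r ?powR_ge0//.
(* Applied to [t^-1], this also bounds [ln t] from below. *)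
have lnle (u : R) : 0 < u -> ln u <= u - 1.
  by move=> u0; have := @le_ln1Dx _ (u - 1); rewrite addrCA subrr addr0; apply; lra.
have pow_ge s : 1 + s * ln t <= t `^ s.
  by rewrite /powR gt_eqF// expR_ge1Dx.
case: hr => hr; last first.
  by apply: le_trans (pow_ge r); rewrite lerD2l ler_wnM2l// lnle.
have := lnle t^-1; rewrite invr_gt0 => /(_ t0); rewrite lnV ?posrE// => hln.
have -> : t `^ r = t * t `^ (r - 1).
  by rewrite pow1B// mulrC divfK ?gt_eqF.
apply: le_trans (_ : t * (1 + (r - 1) * (1 - t^-1)) <= _).
  by rewrite le_eqVlt; apply/orP; left; apply/eqP; field; rewrite gt_eqF.
rewrite ler_wpM2l ?(ltW t0)//; apply: le_trans (pow_ge _).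
by rewrite lerD2l ler_wpM2l; lra.
Qed.

(** Each step of the induction raises [k ^ (p + 1) / (p + 1)] by at least
    [k ^ p]; the largest term stays outside the comparison. *)
Lemma sum_powR_le (R : realType) (p : R) (k : nat) : 0 <= p -> (0 < k)%N ->
  \sum_(j < k) j.+1%:R `^ p <= k%:R `^ p + k%:R `^ (p + 1) / (p + 1).
Proof.
move=> p0; case: k => // k _; have p1 : 0 < p + 1 by lra.
elim: k => [|k IH].
  by rewrite big_ord_recr big_ord0/= add0r powR1 lerDl divr_ge0// ltW.
rewrite big_ord_recr/= addrC lerD2l; apply: le_trans IH _.
rewrite ler_pdivlMr// mulrDl divfK ?gt_eqF//.
have := @powR_tangent R k.+1%:R k.+2%:R (p + 1).
rewrite !ltr0n addrK -natrB// subSnn mulr1 => /(_ isT isT) h.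
by rewrite addrC mulrC; apply: h; left; lra.
Qed.

(** Each term is at most a difference of two consecutive values of
    [x ^ (1 - p) / (p - 1)], and these differences telescope. *)
Lemma sum_powRN_tail_le (R : realType) (p : R) (k N : nat) : 1 < p ->
  (0 < k)%N ->
  \sum_(i < N) (k + i).+1%:R `^ (- p) <= k%:R `^ (1 - p) / (p - 1).
Proof.
move=> p1 k0; have p10 : 0 < p - 1 by lra.
rewrite ler_pdivlMr// mulr_suml.
apply: le_trans (_ : k%:R `^ (1 - p) - (k + N)%:R `^ (1 - p) <= _); last first.
  by rewrite gerBl powR_ge0.
elim: N => [|N IH]; first by rewrite big_ord0 addn0 subrr.
rewrite big_ord_recr/=; apply: le_trans (lerD IH (lexx _)) _.
have kN0 : 0 < (k + N)%:R :> R by rewrite ltr0n addn_gt0 k0.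
rewrite addnS -natr1; set x := (k + N)%:R in kN0 *.
have := @powR_tangent R (x + 1) x (1 - p) (addr_gt0 kN0 ltr01) kN0.
rewrite (_ : 1 - p - 1 = - p); last by ring.
rewrite (_ : x - (x + 1) = -1); last by ring.
by rewrite subr_le0 => /(_ (or_intror (ltW p1))); lra.
Qed.

(** * Maximum and minimum of a list *)

Lemma le_seq_max (R : realType) (s : seq R) (x : R) : x \in s -> x <= seq_max s.
Proof. by move=> xs; exact: (@le_bigmax_seq _ _ _ _ _ _ xpredT id xs). Qed.

Lemma seq_min_le (R : realType) (s : seq R) (x : R) : x \in s -> seq_min s <= x.
Proof. by move=> xs; exact: (@ge_bigmin_seq _ _ _ _ _ _ xpredT id xs). Qed.

Lemma seq_min_gt0 (R : realType) (s : seq R) : (0 < size s)%N ->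
  (forall x, x \in s -> 0 < x) -> 0 < seq_min s.
Proof.
case: s => // a s _ h; rewrite /seq_min big_seq.
apply: (big_ind (fun y => 0 < y)) => [|x y x0 y0|x /h//].
  by apply: h; rewrite inE eqxx.
by rewrite lt_min x0.
Qed.

(** * Entries and norm of Delta *)

(* The nodes are a sequence on all of [nat], as the Lagrange basis of the
   library expects; only its first [n] values come from [sigma]. *)
Section DeltaBound.
Variables (R : realType) (n : nat) (sigma beta : 'I_n -> R).
Variables (k : nat) (hk : (k <= n)%N) (x : nat -> R).
Hypothesis sigmaE : forall i : 'I_n, sigma i ^+ 2 = x i.
Hypothesis x_inj : injective x.
Hypothesis k_gt0 : (0 < k)%N.

Lemma DeltaE (i : 'I_(n - k)) (j : 'I_k) :
  (forall i, sigma i != 0) -> (forall i, beta i != 0) ->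
  Delta sigma beta hk i j =
    sigma (bot_index hk i) * beta (bot_index hk i)
    * \prod_(l < k | l != j) ((x (k + i) - x l) / (x j - x l))
    / (sigma (top_index hk j) * beta (top_index hk j)).
Proof.
move=> sigma0 beta0.
pose d (l : nat) (f : 'I_l -> 'I_n) : 'rV[R]_l :=
  \row_i (sigma (f i) * beta (f i)).
have dE l (f : 'I_l -> 'I_n) : injective f ->
    mxsub f f (Dmx sigma beta) = diag_mx (d l f).
  by move=> f_inj; apply/matrixP => p q; rewrite !mxE (inj_eq f_inj).
have top_inj : injective (top_index hk).
  by move=> p q /cast_ord_inj/lshift_inj.
have bot_inj : injective (bot_index hk).
  by move=> p q /cast_ord_inj/rshift_inj.
have T1E : rowsub (top_index hk) (Tmx sigma k) =
    \matrix_(p < k, l < k) x p ^+ l.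
  by apply/matrixP => p l; rewrite !mxE exprM sigmaE.
have T2E : rowsub (bot_index hk) (Tmx sigma k) =
    \matrix_(p < n - k, l < k) x (k + p) ^+ l.
  by apply/matrixP => p l; rewrite !mxE exprM sigmaE.
rewrite /Delta !dE// T1E T2E -(mulmxA (diag_mx _)) vandermonde_interpolation//.
set E := (\matrix_(_, _) _).
(* Right multiplication by the inverse of a diagonal matrix divides the columns. *)
have -> : diag_mx (d _ (bot_index hk)) *m E *m invmx (diag_mx (d k (top_index hk)))
    = \matrix_(p, q) ((diag_mx (d _ (bot_index hk)) *m E) p q / d k (top_index hk) 0 q).
  apply: canLR (mulmxK _) _.
    rewrite unitmxE det_diag unitfE; apply/prodf_neq0 => q _.
    by rewrite mxE mulf_neq0.
  apply/matrixP => p q; rewrite mul_mx_diag !mxE divfK//.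
  by rewrite mulf_neq0.
by rewrite mxE mul_diag_mx !mxE lagrange_eval.
Qed.

Hypothesis x_gt0 : forall l, 0 < x l.
Hypothesis x_decr : forall p q, (p <= q)%N -> x q <= x p.

Lemma abs_lagrange0E (j : 'I_k) :
  abs_lagrange0 sigma k (top_index hk j) =
  \prod_(l < k | l != j) (x l / `|x j - x l|).
Proof.
rewrite (big_ord_widen_cond n (fun l => l != j) (fun l => x l / `|x j - x l|))//.
rewrite /abs_lagrange0; apply: eq_big => [l|l _]; first by rewrite andbC.
by rewrite !sigmaE.
Qed.

(** Factorwise: [0 < x (k + i) <= x l] gives
    [|x (k + i) - x l| <= x l]. *)
Lemma lagrange_le_at0 (i : 'I_(n - k)) (j : 'I_k) :
  `|\prod_(l < k | l != j) ((x (k + i) - x l) / (x j - x l))|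
  <= abs_lagrange0 sigma k (top_index hk j).
Proof.
rewrite abs_lagrange0E normr_prod; apply: ler_prod => l _.
rewrite normr_ge0 normf_div ler_wpM2r ?invr_ge0//.
have := @x_decr l (k + i) (leq_trans (ltnW (ltn_ord l)) (leq_addr _ _)).
by have := x_gt0 (k + i); rewrite ler_norml; lra.
Qed.

(** The bounds [M], [mu] and [L] are kept abstract because the two cases of the
    theorem express them differently. *)
Lemma spectral_norm_Delta_le (M mu L : R) :
  0 < mu -> 0 <= M -> 0 <= L ->
  (forall i, sigma i != 0) -> (forall i, beta i != 0) ->
  (forall i : 'I_n, (k <= i)%N -> `|beta i| <= M) ->
  (forall i : 'I_n, (i < k)%N -> mu <= `|beta i|) ->
  (forall j : 'I_n, (j < k)%N -> abs_lagrange0 sigma k j <= L) ->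
  spectral_norm (Delta sigma beta hk) <= M / mu *
    Num.sqrt ((\sum_(i < n - k) x (k + i)) * \sum_(j < k) (x j)^-1) * L.
Proof.
move=> mu0 M0 L0 sigma0 beta0 hM hmu hL.
apply: le_trans (spectral_norm_le_frobenius _) _.
rewrite mulrAC -[leRHS]ger0_norm ?mulr_ge0 ?sqrtr_ge0 ?invr_ge0 ?(ltW mu0)//.
rewrite normrM (ger0_norm (sqrtr_ge0 _)) -[X in X * _]sqrtr_sqr -sqrtrM ?sqr_ge0//.
apply: ler_wsqrtr; rewrite mulr_suml mulr_sumr; apply: ler_sum => i _.
rewrite mulr_sumr mulr_sumr; apply: ler_sum => j _.
rewrite DeltaE//; set P := \prod_(_ < _ | _) _.
set si := sigma (bot_index hk i); set sj := sigma (top_index hk j).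
set bi := beta (bot_index hk i); set bj := beta (top_index hk j).
have -> : (si * bi * P / (sj * bj)) ^+ 2 = (bi / bj * P) ^+ 2 * (si ^+ 2 / sj ^+ 2).
  by field; rewrite /sj /bj sigma0 beta0.
rewrite /si /sj !sigmaE /=; apply: ler_wpM2r.
  by rewrite divr_ge0// ltW.
rewrite -[leLHS]real_normK ?num_real// lerXn2r ?nnegrE ?mulr_ge0//.
  by rewrite invr_ge0 ltW.
rewrite normrM normf_div; apply: ler_pM => //; last first.
  by apply: le_trans (lagrange_le_at0 i j) _; apply: hL => /=.
apply: ler_pM => //; first by apply: hM; exact: leq_addr.
by rewrite lef_pV2 ?posrE ?normr_gt0 ?beta0//; apply: hmu => /=.
Qed.

End DeltaBound.

(** * Power decay of the singular values *)

Section PowerDecay.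
Variables (R : realType) (zeta alpha : R).
Hypothesis halpha : 2^-1 < alpha.
Hypothesis zeta_gt0 : 0 < zeta.

(** The squares of the singular values [zeta * (l + 1) ^ - alpha], continued to
    all indices. *)
Definition power_node (l : nat) : R := zeta ^+ 2 * l.+1%:R `^ (- (2 * alpha)).

Let p_gt1 : 1 < 2 * alpha.
Proof. by rewrite -ltr_pdivrMl// mulr1. Qed.

Let p_gt0 : 0 < 2 * alpha.
Proof. exact: lt_trans p_gt1. Qed.

Lemma power_node_gt0 l : 0 < power_node l.
Proof. by rewrite mulr_gt0 ?exprn_gt0// powR_gt0. Qed.

Lemma power_node_decr p q : (p <= q)%N -> power_node q <= power_node p.
Proof.
move=> pq; rewrite ler_wpM2l ?sqr_ge0// !powRN lef_pV2 ?posrE ?powR_gt0//.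
by apply: ge0_ler_powR; rewrite ?nnegrE ?ler_nat// ltW.
Qed.

Lemma power_node_inj : injective power_node.
Proof.
have z20 : zeta ^+ 2 != 0 by rewrite expf_neq0// gt_eqF.
move=> p q /(mulfI z20); rewrite !powRN => /invr_inj.
move=> /(powR_injective p_gt0); rewrite !nnegrE !ler0n => /(_ isT isT) /eqP.
by rewrite eqr_nat eqSS => /eqP.
Qed.

Lemma power_decay_sqr n (sigma : 'I_n -> R) : power_decay sigma zeta alpha ->
  forall i, sigma i ^+ 2 = power_node i.
Proof.
move=> hs i; rewrite hs exprMn; congr (_ * _).
rewrite -powR_mulrn ?powR_ge0// -powRrM.
by rewrite mulNr (mulrC alpha).
Qed.

Lemma power_node_sums k N :
  (\sum_(i < N) power_node (k + i)) * (\sum_(j < k) (power_node j)^-1) =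
  (\sum_(i < N) (k + i).+1%:R `^ (- (2 * alpha)))
  * \sum_(j < k) j.+1%:R `^ (2 * alpha).
Proof.
have z20 : zeta ^+ 2 != 0 by rewrite expf_neq0// gt_eqF.
rewrite -mulr_sumr.
rewrite [X in _ * X = _](_ : _ = (zeta ^+ 2)^-1 * \sum_(j < k) j.+1%:R `^ (2 * alpha)).
  by rewrite mulrACA divff// mul1r.
by rewrite mulr_sumr; apply: eq_bigr => j _; rewrite invfM powRN invrK.
Qed.

(** With [p = 2 alpha], the product of the two comparison bounds is
    [k / (p - 1) + k ^ 2 / ((p - 1) (p + 1))]. *)
Lemma power_node_sums_le k N : (0 < k)%N ->
  (\sum_(i < N) power_node (k + i)) * (\sum_(j < k) (power_node j)^-1) <=
  k%:R ^+ 2 / (4 * alpha ^+ 2 - 1) + k%:R / (2 * alpha - 1).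
Proof.
move=> k0; rewrite power_node_sums.
have k0R : 0 < k%:R :> R by rewrite ltr0n.
apply: le_trans (ler_pM _ _ (sum_powRN_tail_le N p_gt1 k0)
                            (sum_powR_le (ltW p_gt0) k0)) _.
- by apply: sumr_ge0 => i _; apply: powR_ge0.
- by apply: sumr_ge0 => i _; apply: powR_ge0.
have powD r s : k%:R `^ (r + s) = k%:R `^ r * k%:R `^ s :> R.
  by rewrite powRD// (gt_eqF k0R) implybT.
rewrite !powD powRr1 ?(ltW k0R)// powRN.
have := powR_gt0 (2 * alpha) k0R; set w := k%:R `^ (2 * alpha) => w0.
rewrite le_eqVlt; apply/orP; left; apply/eqP; field.
by have p1 := p_gt1; rewrite !gt_eqF//; nra.
Qed.

Lemma power_node_sums1_le N :
  (\sum_(i < N) power_node (1 + i)) * (\sum_(j < 1) (power_node j)^-1) <=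
  1 / (2 * alpha - 1).
Proof.
rewrite power_node_sums big_ord1 powR1 mulr1.
have := @sum_powRN_tail_le R (2 * alpha) 1 N; rewrite powR1.
exact.
Qed.

End PowerDecay.

(** * The bounds on the norm of Delta *)

Theorem theorem4p4 (R : realType) (m n : nat) (hnm : (n <= m)%N)
    (A : 'M[R]_(m, n)) (U : 'M[R]_m) (V : 'M[R]_n) (sigma : 'I_n -> R)
    (b : 'cV[R]_m) (zeta alpha : R)
    (hsvd : is_svd A U sigma V)
    (hb : forall i : 'I_n, fourier_coef hnm U b i != 0)
    (hill : moderately_ill_posed alpha \/ mildly_ill_posed alpha)
    (halpha : 2^-1 < alpha) (hzeta : 0 < zeta)
    (hsigma : power_decay sigma zeta alpha) :
  let beta := fourier_coef hnm U b in
  (forall h1 : (1 < n)%N,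
     spectral_norm (Delta sigma beta (ltnW h1)) <=
       seq_max [seq `|beta i| | i : 'I_n <- enum 'I_n & (1 <= i)%N]
         / `|beta (Ordinal (ltnW h1))|
       * Num.sqrt (1 / (2 * alpha - 1)))
  /\
  (forall (k : nat) (hk : (k < n)%N), (2 <= k)%N ->
     spectral_norm (Delta sigma beta (ltnW hk)) <=
       seq_max [seq `|beta i| | i : 'I_n <- enum 'I_n & (k <= i)%N]
         / seq_min [seq `|beta i| | i : 'I_n <- enum 'I_n & (i < k)%N]
       * Num.sqrt (k%:R ^+ 2 / (4 * alpha ^+ 2 - 1) + k%:R / (2 * alpha - 1))
       * max_abs_lagrange0 sigma k).
Proof.
move=> beta.
have sigma0 i : sigma i != 0 by rewrite hsigma gt_eqF// mulr_gt0// powR_gt0.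
have sigmaE := power_decay_sqr hsigma.
have x_inj := power_node_inj halpha hzeta.
have x_gt0 := power_node_gt0 alpha hzeta.
have x_decr := power_node_decr zeta halpha.
have in_seq (P : pred 'I_n) (f : 'I_n -> R) i : P i ->
    f i \in [seq f i | i : 'I_n <- enum 'I_n & P i].
  by move=> Pi; apply: map_f; rewrite mem_filter Pi mem_enum.
have max_ge k (i : 'I_n) : (k <= i)%N ->
    `|beta i| <= seq_max [seq `|beta i| | i : 'I_n <- enum 'I_n & (k <= i)%N].
  by move=> ki; apply/le_seq_max/(in_seq (fun i : 'I_n => k <= i)%N).
split=> [h1|k hk k2].
  set M := seq_max _; set mu := `|_ (Ordinal _)|.
  have mu0 : 0 < mu by rewrite normr_gt0 hb.
  have M0 : 0 <= M by apply: le_trans (max_ge 1%N (Ordinal h1) _).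
  apply: le_trans (spectral_norm_Delta_le (ltnW h1) sigmaE x_inj _ x_gt0 x_decr
    mu0 M0 ler01 sigma0 hb (max_ge 1%N) _ _) _ => //.
  - move=> i; rewrite ltnS leqn0 => /eqP i0.
    by rewrite /mu (_ : Ordinal _ = i)//; apply: val_inj.
  (* The product defining [L_0] at 0 is empty. *)
  - move=> j; rewrite ltnS leqn0 => /eqP j0; rewrite /abs_lagrange0 big1// => i.
    rewrite ltnS leqn0 => /andP[/eqP i0 /negP[]].
    by apply/eqP/val_inj; rewrite /= i0 j0.
  rewrite mulr1 ler_wpM2l ?divr_ge0 ?(ltW mu0)//.
  by apply: ler_wsqrtr; apply: power_node_sums1_le.
have k0 : (0 < k)%N by apply: leq_trans k2.
have n0 : (0 < n)%N by apply: leq_trans hk.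
set M := seq_max _; set mu := seq_min _.
have mu0 : 0 < mu.
  apply: seq_min_gt0 => [|y /mapP[i _ ->]]; last by rewrite normr_gt0 hb.
  have := in_seq (fun i : 'I_n => i < k)%N (fun i => `|beta i|) (Ordinal n0) k0.
  by case: [seq _ | _ <- _ & _].
have M0 : 0 <= M by apply: le_trans (max_ge k (Ordinal hk) _).
have L_ge (j : 'I_n) : (j < k)%N -> abs_lagrange0 sigma k j <= max_abs_lagrange0 sigma k.
  by move=> jk; apply/le_seq_max/(in_seq (fun i : 'I_n => i < k)%N).
have L0 : 0 <= max_abs_lagrange0 sigma k.
  apply: le_trans (L_ge (Ordinal n0) k0); apply: prodr_ge0 => i _.
  by rewrite divr_ge0// sqr_ge0.
apply: le_trans (spectral_norm_Delta_le (ltnW hk) sigmaE x_inj k0 x_gt0 x_decr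
  mu0 M0 L0 sigma0 hb (max_ge k) _ L_ge) _.
  by move=> i ik; apply/seq_min_le/(in_seq (fun i : 'I_n => i < k)%N).
rewrite ler_wpM2r// ler_wpM2l ?divr_ge0 ?(ltW mu0)//.
by apply: ler_wsqrtr; apply: power_node_sums_le.
Qed.
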